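(* There exists no function $f:\mathbb{N}\to\mathbb{N}$ with $\lim_{n\to\infty}f(n)=\infty$ and with the following property: for every $n$ and every cubic vertex-transitive graph $\Gamma$ with $n$ vertices, $\Gamma$ has a semiregular automorphism of order at least $f(n)$.
   Context: Graphs are finite, connected, with no loops and no multiple edges. A graph is cubic if it is regular of valency $3$. A graph $\Gamma$ is vertex-transitive if its automorphism group $\mathrm{Aut}(\Gamma)$ acts transitively on the vertices of $\Gamma$. A permutation $g$ of a finite set $\Omega$ is semiregular if $1$ is the only element of the cyclic group $\langle g\rangle$ fixing some point of $\Omega$ (equivalently, in the disjoint cycle decomposition of $g$ all cycles have the same length). An automorphism of a graph is semiregular if it is semiregular as a permutation of the vertices. *)

(* Defs.v *)
From HB Require Import structures.
From mathcomp Require Import all_boot all_fingroup.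

Set Implicit Arguments.
Unset Strict Implicit.
Unset Printing Implicit Defensive.

Section Graphs.

Variable T : finType.

Definition simple_graph (e : rel T) : Prop := symmetric e /\ irreflexive e.

(* The empty graph satisfies this predicate, but it is not vertex-transitive in
   the sense below. *)
Definition connected_graph (e : rel T) : Prop := forall x y, connect e x y.

Definition cubic (e : rel T) : Prop := forall x, #|[set y | e x y]| = 3.

Definition Aut_graph (e : rel T) : {set {perm T}} :=
  [set g : {perm T} | [forall x, forall y, e (g x) (g y) == e x y]].

Lemma Aut_graphP (e : rel T) (g : {perm T}) :
  reflect (forall x y, e (g x) (g y) = e x y) (g \in Aut_graph e).
Proof. by rewrite inE; apply: 'forall_'forall_eqP. Qed.

Lemma Aut_graph_group_set (e : rel T) : group_set (Aut_graph e).
Proof.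
apply/group_setP; split=> [|g h /Aut_graphP ge /Aut_graphP he].
  by apply/Aut_graphP => x y; rewrite !perm1.
by apply/Aut_graphP => x y; rewrite !permM he ge.
Qed.

Canonical Aut_graph_group (e : rel T) := Group (Aut_graph_group_set e).

(* [transitive _, on S | _] requires S to be an orbit, hence nonempty. *)
Definition vertex_transitive (e : rel T) : Prop :=
  [transitive Aut_graph e, on [set: T] | 'P].

Definition semiregular_perm (g : {perm T}) : Prop :=
  forall h, h \in <[g]>%g -> (exists x, h x = x) -> h = 1%g.

End Graphs.

Definition tends_to_infinity (f : nat -> nat) : Prop :=
  forall M, exists N, forall n, N <= n -> M <= f n.

(* Main.v *)
Require Import Defs.
From HB Require Import structures.
From mathcomp Require Import all_boot all_fingroup.
From mathcomp Require Import all_algebra cyclic pgroup sylow ring zify.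

(** A family of cubic vertex-transitive graphs, of unbounded size, is built in
    which every semiregular automorphism has order at most 6; this excludes a
    lower bound that tends to infinity.

    Let N = 2^a >= 4 and let K be the 3-group of exponent 3 on F_3^N x F_3 with
    law (v,t)(w,s) = (v + w, t + s + omega(v,w)), where omega is the
    alternating form with omega(e_i, e_k) = 1 for i < k.  The generators e_i,
    i in Z/N, have the rigidity that is wanted: the map e_i |-> e_(i+1), with
    the twist e_(N-1) |-> - e_0 at the wrap-around, extends to an automorphism
    of K, while a rotation with signs of product 1 does not, because all the
    commutators [e_i, e_k] with i < k are the same central element.
    The graph has vertices (x, i, b) in K x Z/N x bool.  One edge at a vertex
    joins (x, i, true) to (x, i+1, false); the other two join (x, i, b) to
    (x e_i, i, ~~ b) and (x e_i^-1, i, ~~ b), and form hexagons indexed by the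
    cosets x<e_i>.  Left translations by K, the twisted rotation and a
    reflection of the indices give vertex-transitivity.

    Automorphisms are understood as follows.  The edges of the second kind lie
    on hexagons and those of the first kind do not ([hop_hexagon],
    [mate_not_hexagon]), so automorphisms commute with the matching formed by
    the first kind and with the antipodal maps of the hexagons.  These two
    involutions generate the closed lines {x} x Z/N x bool.  Lines are thus
    mapped to lines, and the same rotation or reflection of the indices occurs
    on all of them ([aut_lines]).  The induced map on K sends e_i-steps to
    steps along the image of e_i, up to signs; the relations (e_i e_k)^3 = 1
    make the signs independent of the base point ([signs_constant]), and the
    commutators determine them up to a global sign ([rotation_signs]).

    Let g be a semiregular automorphism.  If g rotates the indices by j <> 0,
    then because N is a power of 2 some power g^n with n even fixes all indices
    and, after an odd number of wrap-arounds, sends e_0-steps to inverse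
    e_0-steps.  Hence g^n has even order, and the involution that is a power of
    it permutes the 3^(N+1) lines, which are odd in number; it fixes a line,
    therefore a vertex, against semiregularity ([not_semiregular_of_flip],
    [semiregular_no_rotation]).  So j = 0 or g reflects the indices, and g^2 fixes
    all indices.  By the same parity argument g^2 keeps all signs, so it is a
    left translation of K, and g^6 = 1 ([semiregular_order]). *)

Set Implicit Arguments.
Unset Strict Implicit.
Unset Printing Implicit Defensive.

Import GRing.Theory.

Lemma cards3_neq (T : finType) (x y z : T) :
  x != y -> x != z -> y != z -> #|[set x; y; z]| = 3.
Proof.
by move=> xy xz yz; rewrite setUC cardsU1 cards2 !inE negb_or !(eq_sym z) xy xz yz.
Qed.

Section Construction.

(** * A 3-group with a twisted cyclic symmetry *)


Local Open Scope ring_scope.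

Variable m : nat.
Notation N := m.+4.
Notation V := 'rV['F_3]_N.

Lemma F3_char : 3%:R = 0 :> 'F_3.
Proof. by apply/eqP. Qed.

Lemma F3_cases (s : 'F_3) : [\/ s = 0, s = 1 | s = -1].
Proof.
case: s => [[|[|[|n]]] lt_s] //.
- by apply: Or31; apply/eqP.
- by apply: Or32; apply/eqP.
- by apply: Or33; apply/eqP.
Qed.

Lemma F3_sqr (s : 'F_3) : s != 0 -> s * s = 1.
Proof. by case: (F3_cases s) => -> // _; apply/eqP. Qed.

Lemma F3_eq_of_neqN (s t : 'F_3) : s != 0 -> t != 0 -> s + t != 0 -> t = s.
Proof. by case: (F3_cases s) => -> // _; case: (F3_cases t) => -> // _. Qed.

Lemma F3_sum0 (s t u : 'F_3) :
  s != 0 -> t != 0 -> u != 0 -> s + t + u = 0 -> s = t.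
Proof.
by case: (F3_cases s) => ->; case: (F3_cases t) => ->;
  case: (F3_cases u) => -> // _ _ _ /eqP.
Qed.

(** The order of the indices is the only datum: all pairs i < k get the same value,
    which is what ties the signs of an automorphism together. *)
Definition sgn (i k : 'I_N) : 'F_3 :=
  if (i < k)%N then 1 else if (k < i)%N then -1 else 0.

Definition omega (v w : V) : 'F_3 := (v *m (\matrix_(i, k) sgn i k) *m w^T) 0 0.

Lemma omegaDl v v' w : omega (v + v') w = omega v w + omega v' w.
Proof. by rewrite /omega !mulmxDl mxE. Qed.

Lemma omegaDr v w w' : omega v (w + w') = omega v w + omega v w'.
Proof. by rewrite /omega linearD mulmxDr mxE. Qed.

Lemma omegaZl s v w : omega (s *: v) w = s * omega v w.
Proof. by rewrite /omega -!scalemxAl mxE. Qed.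

Lemma omegaZr s v w : omega v (s *: w) = s * omega v w.
Proof. by rewrite /omega linearZ -scalemxAr mxE. Qed.

Lemma omega_delta i k : omega 'e_i 'e_k = sgn i k.
Proof. by rewrite /omega -rowE trmx_delta -colE !mxE. Qed.

Lemma sgnC i k : sgn k i = - sgn i k.
Proof. by rewrite /sgn; case: ltngtP; rewrite ?opprK ?oppr0. Qed.

Lemma omegaC v w : omega w v = - omega v w.
Proof.
rewrite /omega; set J := \matrix_(i, k) _.
have JT : J^T = - J by apply/matrixP=> i k; rewrite !mxE sgnC.
by rewrite -[w *m J *m v^T]trmxK mxE !trmx_mul trmxK JT mulmxA mulmxN mulNmx mxE.
Qed.

Lemma omega0l w : omega 0 w = 0.
Proof. by rewrite -(scale0r 0) omegaZl mul0r. Qed.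

Lemma omega_self v : omega v v = 0.
Proof.
have h : 2%:R * omega v v = 0.
  by rewrite mulr_natl mulr2n -[X in X + _]opprK -omegaC addNr.
have -> : omega v v = 3%:R * omega v v - 2%:R * omega v v by ring.
by rewrite h F3_char mul0r subrr.
Qed.

Definition K : finType := (V * 'F_3)%type.

Definition hmul (x y : K) : K := (x.1 + y.1, x.2 + y.2 + omega x.1 y.1).

Definition hone : K := (0, 0).

Lemma hmulA x y z : hmul x (hmul y z) = hmul (hmul x y) z.
Proof. by congr pair; rewrite /= ?addrA // omegaDl omegaDr; ring. Qed.

Lemma hmul1x x : hmul hone x = x.
Proof. by case: x => v t; rewrite /hmul /= omega0l !add0r addr0. Qed.

Lemma hmulx1 x : hmul x hone = x.
Proof. by case: x => v t; rewrite /hmul /= omegaC omega0l oppr0 !addr0. Qed.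

Lemma hmul_cube x : hmul x (hmul x x) = hone.
Proof.
case: x => v t; congr pair; rewrite /= ?omegaDr ?omega_self.
  by rewrite -[v]scale1r -!scalerDl (_ : 1 + (1 + 1) = 0) ?scale0r //; apply/eqP.
have -> : t + (t + t + 0) + (0 + 0) = 3%:R * t by ring.
by rewrite F3_char mul0r.
Qed.

Lemma hmul_cubeK x y : hmul x (hmul x (hmul x y)) = y.
Proof. by rewrite !hmulA -[hmul (hmul x x) x]hmulA hmul_cube hmul1x. Qed.

Definition gen (i : 'I_N) (s : 'F_3) : K := (s *: 'e_i, 0).

Definition step (x : K) i s : K := hmul x (gen i s).

Lemma step_fst x i s : (step x i s).1 = x.1 + s *: 'e_i.
Proof. by []. Qed.

Lemma step0 x i : step x i 0 = x.
Proof. by rewrite /step /gen scale0r hmulx1. Qed.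

Lemma stepD x i s t : step (step x i s) i t = step x i (s + t).
Proof.
rewrite /step -hmulA; congr hmul; congr pair => /=; first by rewrite scalerDl.
by rewrite omegaZl omegaZr omega_self; ring.
Qed.

Lemma stepK x i s : step (step x i s) i (- s) = x.
Proof. by rewrite stepD subrr step0. Qed.

Lemma step_coord x i s k : (step x i s).1 0 k = x.1 0 k + s *+ (k == i).
Proof. by rewrite step_fst !mxE eqxx /= mulr_natr. Qed.

Lemma step_inj x i s i' s' :
  s != 0 -> step x i s = step x i' s' -> i = i' /\ s = s'.
Proof.
move=> s0 E; have /(congr1 (fun z : K => z.1 0 i)) := E.
rewrite 2!step_coord (eqxx i) mulr1n => /addrI; case: (i =P i') => [-> ->//|_ /= h].
by rewrite h eqxx in s0.
Qed.

(** The commutator of two generators is central and depends only on [sgn i k];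
    the coefficient 2 that the alternating form produces is -1 in F_3. *)
Lemma step_commutator x i k s t :
  step (step (step (step x i s) k t) i (- s)) k (- t)
  = (x.1, x.2 - s * t * sgn i k).
Proof.
congr pair; rewrite /=.
  by rewrite !scaleNr (addrAC _ (t *: _)) !addrK.
rewrite !omegaDl !omegaZl !omegaZr !omega_delta (sgnC i k).
have -> : sgn i i = 0 by rewrite /sgn ltnn.
have -> : sgn k k = 0 by rewrite /sgn ltnn.
apply/eqP; rewrite -subr_eq0; apply/eqP.
transitivity (3%:R * (s * t * sgn i k)); last by rewrite F3_char mul0r.
ring.
Qed.

(** K is generated by the [gen i s]: the first two basis vectors have a
    nontrivial commutator, so the centre is reached, and the sums of multiples of
    basis vectors reach every first component up to a central factor. *)
Lemma step_ind (P : K -> Prop) :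
  P hone -> (forall x i s, P x -> P (step x i s)) -> forall x, P x.
Proof.
move=> P1 PS.
pose T g := forall x, P x -> P (hmul x g).
have TM g h : T g -> T h -> T (hmul g h) by move=> Tg Th x Px; rewrite hmulA; apply/Th/Tg.
have Tgen i s : T (gen i s) by move=> x /PS; apply.
have Tc t : T (0, t).
  move=> x Px.
  (* [sgn 0 1 = 1], so the commutator with s = - t, t = 1 adds t. *)
  have -> : hmul x (0, t) = (x.1, x.2 - (-t) * 1 * sgn (0 : 'I_N) 1).
    congr pair; rewrite /= ?addr0 // omegaC omega0l /sgn /=; ring.
  by rewrite -step_commutator; do 4!apply: (PS).
have TV v : exists t, T (v, t).
  rewrite (row_sum_delta v).
  apply: (big_ind (fun v => exists t, T (v, t))) => [|v1 v2 [t1 T1] [t2 T2]|i _].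
  - by exists 0; apply: Tc.
  - by exists (t1 + t2 + omega v1 v2); apply: (TM _ _ T1 T2).
  - by exists 0; apply: Tgen.
case=> v t; have [t0 T0] := TV v.
rewrite -[(v, t)]hmul1x; have -> : (v, t) = hmul (v, t0) (0, t - t0).
  by congr pair; rewrite /= ?addr0 // omegaC omega0l; ring.
by apply: TM P1.
Qed.

Lemma odd_card_K : odd #|{: K}|.
Proof. by rewrite card_prod card_mx card_Fp // mul1n oddM oddX orbT. Qed.

(** The sign that comes with e_i under the twisted rotation by j. *)
Definition wrap (j i : 'I_N) : 'F_3 := if (i + j < N)%N then 1 else -1.

Lemma val_shift (i j : 'I_N) :
  (i + j : 'I_N) = (if (i + j < N)%N then i + j else i + j - N)%N :> nat.
Proof.
rewrite /=; case: ltnP => [/modn_small//|le_N].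
have := ltn_ord i; have := ltn_ord j => ltj lti.
by rewrite -[X in (X %% _)%N](subnK le_N) modnDr modn_small //; lia.
Qed.

(** An index that wraps around is moved below all those that do not, which
    reverses exactly the pairs with one wrapping index. *)
Lemma sgn_shift j i k : sgn (i + j) (k + j) = wrap j i * wrap j k * sgn i k.
Proof.
rewrite /sgn /wrap !val_shift.
case: j i k => [a lt_a] [b lt_b] [c lt_c] /=.
case: (ltnP (b + a)%N N) => hab; case: (ltnP (c + a)%N N) => hcb;
  do ?[case: ifP => ?]; try lia; try ring.
Qed.

Lemma rev_ordE (i : 'I_N) : rev_ord i = -1 - i.
Proof.
have h : (rev_ord i)%:R + (i.+1)%:R = 0 :> 'I_N.
  by rewrite -natrD subnK ?ltn_ord // (@pchar_Zp N).
apply/eqP; rewrite -subr_eq0 opprD opprK addrA -h natr_Zp -natr1 natr_Zp.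
by apply/eqP; ring.
Qed.

Lemma sgn_rev i k : sgn (-1 - i) (-1 - k) = - sgn i k.
Proof.
rewrite -!rev_ordE -sgnC /sgn; case: i k => [a lt_a] [b lt_b] /=.
by do ?[case: ifP => ?]; try lia.
Qed.

Definition monomial (s : 'I_N -> 'I_N) (eps : 'I_N -> 'F_3) : 'M['F_3]_N :=
  \matrix_(i < N) (eps i *: 'e_(s i)).

Lemma monomial_delta s eps i : ('e_i : V) *m monomial s eps = eps i *: 'e_(s i).
Proof. by rewrite -rowE rowK. Qed.

Lemma omega_monomial s eps eta v w :
    (forall i k, eps i * eps k * sgn (s i) (s k) = eta * sgn i k) ->
  omega (v *m monomial s eps) (w *m monomial s eps) = eta * omega v w.
Proof.
move=> h; rewrite (row_sum_delta v) (row_sum_delta w) !mulmx_suml.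
have suml u (F : 'I_N -> V) : omega (\sum_j F j) u = \sum_j omega (F j) u.
  apply: (big_morph (omega^~ u)) => [x y|]; [exact: omegaDl|exact: omega0l].
have sumr u (F : 'I_N -> V) : omega u (\sum_j F j) = \sum_j omega u (F j).
  apply: (big_morph (omega u)) => [x y|]; first exact: omegaDr.
  by rewrite omegaC omega0l oppr0.
rewrite !suml big_distrr; apply: eq_bigr => i _ /=.
rewrite !sumr big_distrr; apply: eq_bigr => k _ /=.
rewrite -!scalemxAl !monomial_delta !omegaZl !omegaZr !omega_delta.
transitivity (v 0 i * w 0 k * (eps i * eps k * sgn (s i) (s k))); first by ring.
by rewrite h; ring.
Qed.

Definition lift_monomial s eps eta (x : K) : K := (x.1 *m monomial s eps, eta * x.2).

(** A monomial matrix that multiplies omega by [eta] acts as a group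
    automorphism of K if the centre is scaled by [eta]. *)
Lemma lift_monomial_step s eps eta :
    (forall i k, eps i * eps k * sgn (s i) (s k) = eta * sgn i k) ->
  forall x i a, lift_monomial s eps eta (step x i a) =
                step (lift_monomial s eps eta x) (s i) (a * eps i).
Proof.
move=> h x i a; congr pair; rewrite /=.
  by rewrite mulmxDl -scalemxAl monomial_delta scalerA.
have := omega_monomial x.1 (a *: 'e_i) h.
by rewrite -scalemxAl monomial_delta scalerA !mulrDr => <-; rewrite mulr0.
Qed.

Lemma lift_monomial_one s eps eta : lift_monomial s eps eta hone = hone.
Proof. by rewrite /lift_monomial /= mul0mx mulr0. Qed.

(** * The graph *)

Definition vertex : finType := (K * 'I_N * bool)%type.

Definition dir (b : bool) : 'I_N := if b then 1 else -1.

Lemma dirN b : dir (~~ b) = - dir b.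
Proof. by case: b; rewrite /dir /= ?opprK. Qed.

Lemma dir_neq b n : (0 < n < 4)%N -> dir b *+ n != 0.
Proof.
move=> /andP[n_gt0 n_lt4].
have n0 : n%:R != 0 :> 'I_N.
  by rewrite Zp_nat -val_eqE /= modn_small -?lt0n // (leq_trans n_lt4).
by case: b; rewrite /dir ?mulNrn ?oppr_eq0.
Qed.

Definition mate (u : vertex) : vertex := (u.1.1, u.1.2 + dir u.2, ~~ u.2).

(** On the hexagon through [u], [hop 1] and [hop (-1)] give the two neighbours
    of [u] and [hop 0] gives the antipode. *)
Definition hop (s : 'F_3) (u : vertex) : vertex :=
  (step u.1.1 u.1.2 s, u.1.2, ~~ u.2).

Definition adj : rel vertex :=
  fun u v => [|| v == mate u, v == hop 1 u | v == hop (-1) u].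

Lemma mateK : involutive mate.
Proof. by case=> [[x i] b]; rewrite /mate /= dirN addrK negbK. Qed.

Lemma hopK s : cancel (hop s) (hop (- s)).
Proof. by case=> [[x i] b]; rewrite /hop /= stepK negbK. Qed.

Lemma hop3 s u : hop s (hop s (hop s u)) = hop 0 u.
Proof.
case: u => [[x i] b]; rewrite /hop /= !stepD negbK.
have -> : s + (s + s) = 3%:R * s by ring.
by rewrite F3_char mul0r.
Qed.

Lemma adjP u v :
  reflect (v = mate u \/ exists2 s, s != 0 & v = hop s u) (adj u v).
Proof.
apply: (iffP or3P) => [[/eqP->|/eqP->|/eqP->]|[->|[s s0 ->]]].
- by left.
- by right; exists 1.
- by right; exists (-1).
- by constructor 1.
- by case: (F3_cases s) s0 => -> // _; [apply: Or32|apply: Or33].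
Qed.

Lemma mate_neq_hop s u : mate u != hop s u.
Proof.
case: u => [[x i] b]; apply/eqP => /(congr1 (fun v : vertex => v.1.2)) /= /eqP.
by rewrite -subr_eq0 addrAC subrr add0r; apply/negP; rewrite (@dir_neq _ 1).
Qed.

Lemma hop_inj s t u : hop s u = hop t u -> s = t.
Proof.
move/(congr1 (fun v : vertex => v.1.1)) => /= E.
case: (eqVneq s 0) E => [->|s0] E; last by case: (step_inj s0 E).
by case: (eqVneq t 0) => [->//|t0]; case: (step_inj t0 (esym E)).
Qed.

Lemma adj_sym : symmetric adj.
Proof.
suff h u v : adj u v -> adj v u by move=> u v; apply/idP/idP; apply: h.
case/adjP => [->|[s s0 ->]]; apply/adjP; first by left; rewrite mateK.
by right; exists (- s); rewrite ?oppr_eq0 ?hopK.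
Qed.

Lemma adj_irr : irreflexive adj.
Proof.
by case=> [[x i] b]; apply/negP => /adjP[|[s _]] /(congr1 snd) /=; case: b.
Qed.

Lemma adj_cubic : cubic adj.
Proof.
move=> u; have -> : [set v | adj u v] = [set mate u; hop 1 u; hop (-1) u].
  by apply/setP=> v; rewrite !inE /adj orbA.
have hop_neq : hop 1 u != hop (-1) u by apply/eqP => /hop_inj.
have m1 := mate_neq_hop 1 u; have m2 := mate_neq_hop (-1) u.
exact: cards3_neq.
Qed.

(** Along a line one alternates between the antipode, reached by three hexagon
    edges, and the matching. *)
Lemma connect_line (x : K) i b : connect adj (x, 0, false) (x, i, b).
Proof.
have ch s u : connect adj u (hop s u).
  have ch1 t v : t != 0 -> connect adj v (hop t v).
    by move=> t0; apply/connect1/adjP; right; exists t.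
  case: (eqVneq s 0) => [->|s0]; last exact: ch1.
  rewrite -(hop3 1); set w := hop 1 u.
  apply: (connect_trans (y := w)); first exact: ch1.
  by apply: (connect_trans (y := hop 1 w)); apply: ch1.
suff hf : connect adj (x, 0, false) (x, i, false).
  case: b => //; apply: connect_trans hf _.
  by have := ch 0 (x, i, false); rewrite /hop /= step0.
rewrite -[i]natr_Zp; elim: (i : nat) => [|n IHn]; first exact: connect0.
apply: connect_trans IHn _; apply: connect_trans (ch 0 _) _.
apply/connect1/adjP; left; by rewrite /mate /hop /= step0 mulrSr.
Qed.

Lemma adj_connected : connected_graph adj.
Proof.
suff h u : connect adj (hone, 0, false) u.
  by move=> u v; apply: connect_trans (h v); rewrite (sym_connect_sym adj_sym).
have h2 : forall x i b, connect adj (hone, 0, false) (x, i, b).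
  apply: step_ind => [|x i s IHx k b]; first exact: connect_line.
  case: (eqVneq s 0) => [->|s0]; first by rewrite step0.
  apply: connect_trans (connect_line _ k b).
  apply: (connect_trans (y := (step x i s, i, true))).
    apply: connect_trans (IHx i false) _; apply/connect1/adjP; right; by exists s.
  by rewrite (sym_connect_sym adj_sym) connect_line.
by case: u => [[x i] b].
Qed.

(** * Vertex-transitivity *)

Definition place (c : bool) (j i : 'I_N) : 'I_N := if c then j - i else i + j.

Lemma place_dir c j i b : place c j (i + dir b) = place c j i + dir (b (+) c).
Proof. by case: c; rewrite /place ?addbT ?addbF ?dirN; ring. Qed.

Lemma place_inj c j : injective (place c j).
Proof. by case: c => i k; [move/addrI/oppr_inj|move/addIr]. Qed.

(** The converse of [aut_lines], for signs that do not depend on the base point. *)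
Lemma aut_of_lines (y : K -> K) c j (eps : 'I_N -> 'F_3) :
    injective y -> (forall i, eps i != 0) ->
    (forall x i s, y (step x i s) = step (y x) (place c j i) (s * eps i)) ->
  exists2 g : {perm vertex}, g \in Aut_graph adj &
    forall x i b, g (x, i, b) = (y x, place c j i, b (+) c).
Proof.
move=> y_inj eps0 yS.
pose phi (u : vertex) : vertex := (y u.1.1, place c j u.1.2, u.2 (+) c).
have phi_inj : injective phi.
  move=> [[x i] b] [[x' i'] b'] E.
  have /y_inj /= -> := congr1 (fun u : vertex => u.1.1) E.
  have /place_inj /= -> := congr1 (fun u : vertex => u.1.2) E.
  by have /addIb /= -> := congr1 snd E.
have phi_mate u : phi (mate u) = mate (phi u).
  by rewrite /phi /mate /= place_dir -addNb.
have phi_hop u s : phi (hop s u) = hop (s * eps u.1.2) (phi u).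
  by rewrite /phi /hop /= yS -addNb.
exists (perm phi_inj); last by move=> x i b; rewrite permE.
apply/Aut_graphP => u v; rewrite !permE.
apply/adjP/adjP => [[|[s s0]]|[->|[s s0 ->]]].
- by rewrite -phi_mate => /phi_inj; left.
- have -> : s = s * eps u.1.2 * eps u.1.2 by rewrite -mulrA F3_sqr ?mulr1.
  rewrite -phi_hop => /phi_inj ->; right; exists (s * eps u.1.2) => //.
  by rewrite mulf_neq0.
- by left.
- by right; exists (s * eps u.1.2); rewrite ?mulf_neq0.
Qed.

Lemma hmul_inj k : injective (hmul k).
Proof.
by move=> x x' /(congr1 (hmul k)) /(congr1 (hmul k)); rewrite !hmul_cubeK.
Qed.

(** Surjectivity follows from the generation of K, hence injectivity by
    finiteness. *)
Lemma lift_monomial_inj s s' eps eta :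
    cancel s' s -> (forall i, eps i != 0) ->
    (forall i k, eps i * eps k * sgn (s i) (s k) = eta * sgn i k) ->
  injective (lift_monomial s eps eta).
Proof.
move=> sK eps0 h.
suff im x : exists z, lift_monomial s eps eta z = x.
  have /image_injP inj : #|image (lift_monomial s eps eta) K| == #|K|.
    by apply/eqP/eq_card => x; have [z <-] := im x; rewrite image_f.
  by move=> x y; apply: inj.
move: x; apply: step_ind => [|x i a [z <-]].
  by exists hone; rewrite lift_monomial_one.
exists (step z (s' i) (a * eps (s' i))).
by rewrite (lift_monomial_step h) sK -mulrA F3_sqr ?mulr1.
Qed.

(** Translations move between lines, the twisted rotations move along a line, and
    reversing the order of the indices exchanges the two kinds of vertices. *)
Lemma adj_transitive : vertex_transitive adj.
Proof.
pose o : vertex := (hone, 0, false).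
suff tr u : exists2 g, g \in Aut_graph adj & g o = u.
  apply/imsetP; exists o => //; apply/setP=> u; rewrite inE.
  by have [g Ag <-] := tr u; rewrite (mem_orbit 'P).
have trans x : exists2 g, g \in Aut_graph adj &
    forall y i b, g (y, i, b) = (hmul x y, i, b).
  have [|//||g Ag gE] := @aut_of_lines (hmul x) false 0 (fun=> 1); first exact: hmul_inj.
    by move=> y i s; rewrite mulr1 /place addr0 /step hmulA.
  by exists g => // y i b; rewrite gE addbF /place addr0.
have rot j : exists2 g, g \in Aut_graph adj &
    forall i b, g (hone, i, b) = (hone, i + j, b).
  have w0 i : wrap j i != 0 by rewrite /wrap; case: ifP.
  have h i k : wrap j i * wrap j k * sgn (i + j) (k + j) = 1 * sgn i k.
    by rewrite sgn_shift mul1r mulrA mulrACA !F3_sqr // !mul1r.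
  have [|//||g Ag gE] :=
    @aut_of_lines (lift_monomial (fun i => i + j) (wrap j) 1) false j (wrap j).
    exact: (lift_monomial_inj (subrK j) w0 h).
    exact: (lift_monomial_step h).
  by exists g => // i b; rewrite gE addbF lift_monomial_one.
have [r Ar rE] : exists2 g, g \in Aut_graph adj &
    forall i b, g (hone, i, b) = (hone, -1 - i, ~~ b).
  have h (i k : 'I_N) : 1 * 1 * sgn (-1 - i) (-1 - k) = -1 * sgn i k.
    by rewrite sgn_rev !mul1r mulN1r.
  have [|//||g Ag gE] :=
    @aut_of_lines (lift_monomial (fun i => -1 - i) (fun=> 1) (-1)) true (-1) (fun=> 1).
    by apply: (lift_monomial_inj (subKr _) _ h).
    exact: (lift_monomial_step h).
  by exists g => // i b; rewrite gE addbT lift_monomial_one.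
case: u => [[x i] b]; have [t At tE] := trans x.
have [f Af fE] : exists2 g, g \in Aut_graph adj & g o = (hone, i, b).
  case: b; last by have [g Ag gE] := rot i; exists g; rewrite // gE add0r.
  have [g Ag gE] := rot (i + 1); exists (r * g)%g; first by rewrite groupM.
  by rewrite permM rE gE; congr (_, _, _); ring.
by exists (f * t)%g; rewrite ?groupM // permM fE tE hmulx1.
Qed.

(** * Automorphisms permute the lines *)

Lemma hop2_neq s u : s != 0 -> hop s (hop s u) != u.
Proof.
move=> s0; apply/eqP => E.
have : hop s u = hop (- s) u by rewrite -[LHS](hopK s) E.
by move/hop_inj; case: (F3_cases s) s0 => -> // _ /eqP.
Qed.

(** The four inequalities are the part of non-backtracking that separates the
    hexagons from the walks that retrace the edge [u v]. *)
Definition on_hexagon (u v : vertex) : Prop :=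
  exists w1 w2 w3 w4,
    [/\ adj v w1, adj w1 w2, adj w2 w3, adj w3 w4 & adj w4 u] /\
    [/\ w1 != u, w2 != v, w3 != u & w4 != v].

Lemma hop_hexagon s u : s != 0 -> on_hexagon u (hop s u).
Proof.
move=> s0; have hopP w : adj w (hop s w) by apply/adjP; right; exists s.
have w6 : hop s (hop s (hop s (hop s (hop s (hop s u))))) = u.
  by rewrite hop3 hop3 -[X in hop X (hop 0 u)]oppr0 hopK.
exists (hop s (hop s u)), (hop s (hop s (hop s u))).
exists (hop s (hop s (hop s (hop s u)))), (hop s (hop s (hop s (hop s (hop s u))))).
split; first split.
- exact: hopP.
- exact: hopP.
- exact: hopP.
- exact: hopP.
- rewrite -[X in adj _ X]w6; exact: hopP.
split.
- exact: hop2_neq.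
- exact: hop2_neq.
- rewrite -[X in _ != X]w6 eq_sym; exact: hop2_neq.
- rewrite -[X in _ != hop s X]w6 eq_sym; exact: hop2_neq.
Qed.

(** A 6-cycle through a matching edge would leave both of its ends along hexagon
    edges.  For the two remaining vertices to be adjacent, indices would have to
    agree that differ by 1, 2 or 3 modulo N >= 4, or a nonzero multiple of one
    basis vector would have to equal a multiple of another. *)
Lemma mate_not_hexagon u : ~ on_hexagon u (mate u).
Proof.
case: u => [[x i] b] [w1 [w2 [w3 [w4 [[vw1 w12 w23 w34 w4u] [w1u w2v w3u w4v]]]]]].
case/adjP: vw1 w1u => [->|[s s0 w1E _]]; first by rewrite mateK eqxx.
move: w4u; rewrite adj_sym; case/adjP => [E|[t t0 w4E]]; first by rewrite E eqxx in w4v.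
move: w34; rewrite adj_sym => w43.
have idx n : (0 < n < 4)%N -> dir b *+ n = 0 -> False.
  by move=> n4 E; have := dir_neq b n4; rewrite E eqxx.
have w2P : w2 = (step x (i + dir b) s, i + dir b + dir b, ~~ b) \/
    exists2 s', s' != 0 & w2 = (step x (i + dir b) s', i + dir b, ~~ b).
  case/adjP: w12 w2v => [->|[s' s'0 ->]]; first by rewrite w1E /mate /= !negbK; left.
  rewrite w1E /hop /= stepD !negbK => h; right; exists (s + s') => //.
  by apply: contraNneq h => ->; rewrite step0.
have w3P : w3 = (step x i t, i - dir b, b) \/
    exists2 t', t' != 0 & w3 = (step x i t', i, b).
  case/adjP: w43 w3u => [->|[t' t'0 ->]]; first by rewrite w4E /mate /= dirN negbK; left.
  rewrite w4E /hop /= stepD !negbK => h; right; exists (t + t') => //.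
  by apply: contraNneq h => ->; rewrite step0.
case: w2P w3P => [->|[s' s'0 ->]] [->|[t' t'0 ->]] in w23;
  case/adjP: w23 => [E|[q _ E]].
all: have /= := congr1 (fun v : vertex => v.1.2) E; rewrite ?dirN => /eqP;
  rewrite -subr_eq0 => /eqP Ei.
- by apply: (idx 2%N) => //; rewrite -oppr0 -Ei; ring.
- by apply: (idx 3%N) => //; rewrite -oppr0 -Ei; ring.
- by apply: (idx 1%N) => //; rewrite -oppr0 -Ei; ring.
- by apply: (idx 2%N) => //; rewrite -oppr0 -Ei; ring.
- by apply: (idx 1%N) => //; rewrite -oppr0 -Ei; ring.
- by apply: (idx 2%N) => //; rewrite -oppr0 -Ei; ring.
(* The indices agree: the steps along e_i and e_(i +- 1) would coincide. *)
- have /= /(step_inj t'0)[] := congr1 (fun v : vertex => v.1.1) E.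
  move=> /eqP; rewrite eq_sym -subr_eq0 addrAC subrr add0r => /eqP d0.
  by case: (idx 1%N).
- by apply: (idx 1%N) => //; rewrite -oppr0 -Ei; ring.
Qed.

Lemma aut_mate (g : {perm vertex}) u : g \in Aut_graph adj -> g (mate u) = mate (g u).
Proof.
move=> /Aut_graphP gA.
have : adj (g u) (g (mate u)) by rewrite gA; apply/adjP; left.
case/adjP => // [[s s0 E]]; case: (@mate_not_hexagon u).
have [w1 [w2 [w3 [w4 [[a0 a1 a2 a3 a4] [n1 n2 n3 n4]]]]]] := hop_hexagon (g u) s0.
rewrite -E {E} in a0 n2 n4.
have gV w v : adj w v -> adj ((g^-1)%g w) ((g^-1)%g v).
  by move=> wv; rewrite -gA !permKV.
have gN w v : w != g v -> (g^-1)%g w != v by rewrite (canF_eq (permKV g)).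
exists (g^-1 w1)%g, (g^-1 w2)%g, (g^-1 w3)%g, (g^-1 w4)%g.
split; split; try exact: gN; try exact: gV.
  by rewrite -gA permKV; exact: a0.
by rewrite -gA permKV; exact: a4.
Qed.

Lemma aut_hop (g : {perm vertex}) u s : g \in Aut_graph adj -> s != 0 ->
  exists2 t, t != 0 & g (hop s u) = hop t (g u).
Proof.
move=> gA s0; have : adj (g u) (g (hop s u)).
  by rewrite (Aut_graphP _ _ gA); apply/adjP; right; exists s.
case/adjP => [|[t t0 E]]; last by exists t.
by rewrite -aut_mate // => /perm_inj E; have := mate_neq_hop s u; rewrite E eqxx.
Qed.

(** Two distinct consecutive hexagon edges go to two such edges, so an
    automorphism keeps the direction of travel around a hexagon. *)
Lemma aut_hop2 (g : {perm vertex}) u s t : g \in Aut_graph adj -> s != 0 -> t != 0 ->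
  g (hop s u) = hop t (g u) -> g (hop s (hop s u)) = hop t (hop t (g u)).
Proof.
move=> gA s0 t0 E; have [t' t'0 E'] := aut_hop (hop s u) gA s0.
rewrite E' E; congr (hop _ _); apply: F3_eq_of_neqN => //.
apply: contraNneq (hop2_neq u s0) => tt'.
rewrite -(inj_eq (@perm_inj _ g)) E' E (_ : t' = - t) ?hopK //.
by apply/eqP; rewrite -addr_eq0 addrC tt'.
Qed.

Lemma aut_antipode (g : {perm vertex}) u :
  g \in Aut_graph adj -> g (hop 0 u) = hop 0 (g u).
Proof.
move=> gA; have [t t0 E] := aut_hop u gA (oner_neq0 _).
have E2 := aut_hop2 gA (oner_neq0 _) t0 E.
have E3 : g (hop 1 (hop 1 u)) = hop t (g (hop 1 u)) by rewrite E2 E.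
by have := aut_hop2 gA (oner_neq0 _) t0 E3; rewrite hop3 E hop3.
Qed.

(** The line is generated from one vertex by the matching and the antipodal
    maps, both of which commute with [g]. *)
Lemma aut_line (g : {perm vertex}) x : g \in Aut_graph adj ->
  forall i b, g (x, i, b) =
    ((g (x, 0, false)).1.1, place (g (x, 0, false)).2 (g (x, 0, false)).1.2 i,
     b (+) (g (x, 0, false)).2).
Proof.
move=> gA; case E0 : (g (x, 0, false)) => [[y j] c] /=.
have flip i b : g (x, i, ~~ b) = hop 0 (g (x, i, b)).
  by rewrite -aut_antipode // /hop /= step0.
suff H i : g (x, i, false) = (y, place c j i, c).
  by move=> i [|]; rewrite ?(flip i false) H ?addTb // /hop /= step0.
rewrite -[i]natr_Zp; elim: (i : nat) => [|n IHn].
  by rewrite E0 /place add0r subr0 if_same.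
have := aut_mate (x, n%:R, true) gA.
rewrite {1}/mate /= -mulrSr => ->; rewrite (flip _ false) IHn /mate /hop /= step0 negbK.
by rewrite mulrSr -[1]/(dir true) place_dir addTb.
Qed.

(** Lines joined by a hexagon undergo the same motion, since the index and the
    orientation can be read off on the common hexagon; as K is generated by the
    steps, the motion is the same everywhere. *)
Lemma aut_lines (g : {perm vertex}) : g \in Aut_graph adj ->
  exists (y : K -> K) (j : 'I_N) (c : bool) (eps : K -> 'I_N -> 'F_3),
  [/\ forall x i b, g (x, i, b) = (y x, place c j i, b (+) c),
      forall x i, eps x i != 0
    & forall x i s, y (step x i s) = step (y x) (place c j i) (s * eps x i)].
Proof.
move=> gA; pose y x := (g (x, 0, false)).1.1.
pose j x := (g (x, 0, false)).1.2; pose c x := (g (x, 0, false)).2.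
have gE x i b : g (x, i, b) = (y x, place (c x) (j x) i, b (+) c x) by apply: aut_line.
have gS x i s : s != 0 -> [/\ c (step x i s) = c x, j (step x i s) = j x &
    exists2 t, t != 0 & y (step x i s) = step (y x) (place (c x) (j x) i) t].
  move=> s0; have [t t0] := aut_hop (x, i, false) gA s0.
  rewrite /hop /= !gE /= => E.
  have cE : c (step x i s) = c x.
    by have /= := congr1 snd E; case: (c _); case: (c _).
  split=> //; last by exists t => //; apply: (congr1 (fun v : vertex => v.1.1) E).
  have /= := congr1 (fun v : vertex => v.1.2) E.
  by rewrite cE /place; case: ifP => _ => [/addIr|/addrI].
have [cE jE] : (forall x, c x = c hone) /\ (forall x, j x = j hone).
  split; apply: step_ind => // x i s IHx; case: (eqVneq s 0) => [->|s0];
    by rewrite ?step0 //; case: (gS x i s s0) => cE jE _; rewrite ?cE ?jE.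
have gE' x i b : g (x, i, b) = (y x, place (c hone) (j hone) i, b (+) c hone).
  by rewrite gE cE jE.
have y_inj : injective y.
  move=> x x' E; have : g (x, 0, false) = g (x', 0, false) by rewrite !gE' E.
  by move/perm_inj/(congr1 (fun v : vertex => v.1.1)).
have epsP x i : exists t, (t != 0) &&
    [forall s, y (step x i s) == step (y x) (place (c hone) (j hone) i) (s * t)].
  have [_ _ [t t0 E]] := gS x i 1 isT; exists t; rewrite t0 /=.
  have [_ _ [t' t'0 E']] := gS x i (-1) isT; rewrite cE jE in E E'.
  apply/forallP => s; apply/eqP.
  case: (F3_cases s) => ->; rewrite ?mul0r ?mul1r ?step0 // mulN1r E'; congr step.
  apply: F3_eq_of_neqN; rewrite ?oppr_eq0 //.
  apply: contraTneq isT; rewrite addrC => /eqP; rewrite subr_eq0 => /eqP tE.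
  have /y_inj : y (step x i 1) = y (step x i (-1)) by rewrite E E' tE.
  by case/step_inj.
exists y, (j hone), (c hone), (fun x i => xchoose (epsP x i)); split => // x i.
  by case/andP: (xchooseP (epsP x i)).
by move=> s; case/andP: (xchooseP (epsP x i)) => _ /forallP/(_ s)/eqP.
Qed.

(** * The signs of an automorphism *)

Lemma step_cube (x : K) i k s t :
  step (step (step (step (step (step x i s) k t) i s) k t) i s) k t = x.
Proof.
pose p := hmul (gen i s) (gen k t).
transitivity (hmul x (hmul p (hmul p p))); first by rewrite /step !hmulA.
by rewrite hmul_cube hmulx1.
Qed.

(** The closed walk (e_i e_k)^3 is sent to a closed walk, so the three signs
    met along e_i sum to zero in F_3, which forces three nonzero signs to agree. *)
Lemma signs_constant (y : K -> K) (sig : 'I_N -> 'I_N) (eps : K -> 'I_N -> 'F_3) :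
    injective sig -> (forall x i, eps x i != 0) ->
    (forall x i s, y (step x i s) = step (y x) (sig i) (s * eps x i)) ->
  forall x i, eps x i = eps hone i.
Proof.
move=> sig_inj eps0 yS.
suff inv x k s i : eps (step x k s) i = eps x i.
  by apply: step_ind => // x k s IHx i; rewrite inv.
have same z : eps (step z i (-1)) i = eps z i.
  have /(congr1 (fun w : K => w.1 0 (sig i))) := yS z i (-1 + 1).
  rewrite -stepD 2!yS stepD !step_coord eqxx !mulr1n => /addrI /eqP.
  by rewrite mulN1r mul1r addNr mul0r addrC subr_eq0 => /eqP.
(* For k = i, additivity of the step compares the two signs. *)
case: (eqVneq k i) => [->|k_i].
  have := yS x i (s + 1); rewrite -stepD !yS stepD => E.
  have /(congr1 (fun w : K => w.1 0 (sig i))) := E.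
  by rewrite !step_coord eqxx !mulr1n => /addrI /eqP;
    rewrite mulrDl !mul1r (inj_eq (addrI _)) => /eqP.
have around z : eps z i = eps (step (step z i 1) k s) i.
  have sig_ik : (sig i == sig k) = false by rewrite (inj_eq sig_inj) eq_sym (negbTE k_i).
  have /(congr1 (fun w : K => (y w).1 0 (sig i))) := step_cube z i k 1 s.
  do 6!rewrite yS; do 6!rewrite step_coord.
  rewrite eqxx sig_ik mulr0n !mulr1n !addr0 !mul1r.
  move/eqP; rewrite -[X in _ == X]addr0 -!addrA (inj_eq (addrI _)) addrA => /eqP.
  exact: F3_sum0.
by rewrite -(same x) [RHS]around stepD addNr step0.
Qed.

(** The commutator of e_i and e_k is the central element of [sgn i k], so pairs
    with the same order have the same commutator, hence images with the same
    commutator. *)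
Lemma signs_commutator (y : K -> K) (sig : 'I_N -> 'I_N) (eps : 'I_N -> 'F_3) :
    (forall x i s, y (step x i s) = step (y x) (sig i) (s * eps i)) ->
  forall i k i' k', sgn i k = sgn i' k' ->
    eps i * eps k * sgn (sig i) (sig k) = eps i' * eps k' * sgn (sig i') (sig k').
Proof.
move=> yS i k i' k' ikE.
have yc a b : y (step (step (step (step hone a 1) b 1) a (-1)) b (-1)) =
    ((y hone).1, (y hone).2 - eps a * eps b * sgn (sig a) (sig b)).
  by rewrite !yS !mulNr !mul1r step_commutator.
have := yc i k; rewrite step_commutator ikE -step_commutator yc.
by move/(congr1 snd) => /= /addrI/oppr_inj.
Qed.

(** Corrected by [wrap], the signs [d i] satisfy [d i * d k = d 0 * d 1] for all
    i <> k; as there are at least three indices, they are all equal. *)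
Lemma rotation_signs (y : K -> K) (j : 'I_N) (eps : 'I_N -> 'F_3) :
    (forall i, eps i != 0) ->
    (forall x i s, y (step x i s) = step (y x) (i + j) (s * eps i)) ->
  exists2 d, d != 0 & forall i, eps i = d * wrap j i.
Proof.
move=> eps0 yS.
have w0 i : wrap j i != 0 by rewrite /wrap; case: ifP.
pose d i := eps i * wrap j i; have d0 i : d i != 0 by rewrite mulf_neq0.
have dlt (i k : 'I_N) : (i < k)%N -> d i * d k = d 0 * d 1.
  move=> lt_ik; have sgn1 : sgn i k = 1 by rewrite /sgn lt_ik.
  have := signs_commutator yS (etrans sgn1 (erefl _ : 1 = sgn 0 1)).
  rewrite !sgn_shift sgn1 /d => E.
  rewrite mulrACA (mulrACA (eps 0)).
  by move: E; rewrite !mulr1.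
have dneq i k : i != k -> d i * d k = d 0 * d 1.
  by rewrite -val_eqE neq_ltn => /orP[/dlt//|/dlt <-]; rewrite mulrC.
exists (d 0) => // i; suff <- : d i = d 0 by rewrite /d -mulrA F3_sqr ?mulr1.
have [l /andP[l0 li]] : exists l : 'I_N, (l != 0) && (l != i).
  (* A third index, different from 0 and i. *)
  case: (eqVneq i 1) => [->|i1]; last by exists 1; rewrite oner_neq0 eq_sym.
  exists (1 *+ 2); rewrite -[1 *+ 2 == 1]subr_eq0 [_ - 1]addrK.
  by rewrite (@dir_neq true 2) ?(@dir_neq true 1).
by apply: (mulIf (d0 l)); rewrite !dneq // eq_sym.
Qed.

Lemma val_mulrn (j : 'I_N) n : (j *+ n : 'I_N) = (n * j %% N)%N :> nat.
Proof. by rewrite -[j in j *+ n]natr_Zp -[_ *+ n]mulr_natr -natrM Zp_nat /= mulnC. Qed.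

(** The exponent of -1 counts the wrap-arounds of the index starting at 0. *)
Lemma rotation_iter (y : K -> K) (j : 'I_N) d :
    (forall x i s, y (step x i s) = step (y x) (i + j) (s * (d * wrap j i))) ->
  forall n x s, iter n y (step x 0 s) =
    step (iter n y x) (j *+ n) (s * (d ^+ n * (-1) ^+ (n * j %/ N))).
Proof.
move=> yS n x s; elim: n => [|n IHn]; first by rewrite div0n !expr0 !mulr1.
rewrite !iterS IHn yS -mulrSr; congr step.
have -> : (-1) ^+ (n.+1 * j %/ N) = (-1) ^+ (n * j %/ N) * wrap j (j *+ n) :> 'F_3.
  rewrite /wrap val_mulrn mulSnr {1}(divn_eq (n * j) N) -addnA divnMDl // exprD.
  congr (_ * _); case: ltnP => [/divn_small -> //|le_N].
  rewrite -(subnK le_N) divnDr // divnn divn_small //.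
  have := ltn_ord j; have : (n * j %% N < N)%N by rewrite ltn_mod.
  lia.
by rewrite exprSr; ring.
Qed.

(** * Semiregular automorphisms *)

(** The sign -1 forces an even order; the involution in the cyclic group of [g]
    then acts on an odd number of lines. *)
Lemma not_semiregular_of_flip (g : {perm vertex}) (z : K -> K) i0 :
    (forall x i b, g (x, i, b) = (z x, i, b)) ->
    (forall x s, z (step x i0 s) = step (z x) i0 (- s)) ->
  ~ semiregular_perm g.
Proof.
move=> gE zS gsr.
have gX n x i b : (g ^+ n)%g (x, i, b) = (iter n z x, i, b).
  by rewrite permX; elim: n => //= n ->; rewrite gE.
have zX n x s : iter n z (step x i0 s) = step (iter n z x) i0 ((-1) ^+ n * s).
  by elim: n => [|n IHn] /=; rewrite ?expr0 ?mul1r // IHn zS exprS mulN1r mulNr.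
have even_g : ~~ odd #[g]%g.
  have := zX #[g]%g hone 1; have id x : iter #[g]%g z x = x.
    by have := gX #[g]%g x 0 false; rewrite expg_order perm1 => -[].
  rewrite !id mulr1 -signr_odd => /step_inj[] // _.
  by case: odd.
have gE2 : #[g]%g = (#[g]%g./2 * 2)%N.
  by rewrite -[LHS]odd_double_half (negbTE even_g) muln2.
pose h := (g ^+ #[g]%g./2)%g.
have h2 : (h ^+ 2 = 1)%g by rewrite -expgM -gE2 expg_order.
pose S := [set ((x, 0, false) : vertex) | x in K].
have cardS : odd #|S|.
  by rewrite card_imset ?odd_card_K // => x x' /(congr1 (fun v : vertex => v.1.1)).
have acts_h : [acts <[h]>%g, on S | 'P].
  rewrite /= cycle_subG; apply/astabsP => u; rewrite [_ u h]apermE.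
  case: u => [[x i] b]; rewrite gX.
  apply/imsetP/imsetP => -[x' _ E];
    have /= -> := congr1 (fun v : vertex => v.1.2) E; have /= -> := congr1 snd E.
    by exists x.
  by exists (iter #[g]%g./2 z x).
have pgrp : (2.-group <[h]>)%g.
  by apply: (@pnat_dvd _ 2); rewrite // -[#|_|]/(#[h]%g) order_dvdn h2.
have := pgroup_fix_mod pgrp acts_h; rewrite !modn2 cardS.
case: (set_0Vmem 'Fix_(S | 'P)(<[h]>)%g) => [->|[u]]; first by rewrite cards0.
rewrite inE => /andP[_ /afixP/(_ h (cycle_id h)) hu _].
have /eqP : h = 1%g by apply: gsr; [exact: mem_cycle|exists u].
rewrite -order_dvdn gE2 => /dvdn_leq.
have := order_gt0 g; rewrite {1}gE2; lia.
Qed.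

Lemma semiregular_expg (g : {perm vertex}) n :
  semiregular_perm g -> semiregular_perm (g ^+ n)%g.
Proof.
by move=> gsr h hg; apply: gsr; apply: (subsetP _ _ hg); rewrite cycle_subG mem_cycle.
Qed.

(** With j = 2^k o, o odd, the exponent n = 2^(a-k) is even and n j = o N, so the
    power g^n fixes the indices after an odd number o of wrap-arounds. *)
Lemma semiregular_no_rotation (a : nat) (g : {perm vertex}) (y : K -> K) (j : 'I_N)
    (eps : K -> 'I_N -> 'F_3) :
    N = (2 ^ a)%N -> semiregular_perm g ->
    (forall x i b, g (x, i, b) = (y x, i + j, b)) ->
    (forall x i, eps x i != 0) ->
    (forall x i s, y (step x i s) = step (y x) (i + j) (s * eps x i)) ->
  j = 0.
Proof.
move=> Na gsr gE eps0 yS; apply/eqP; apply: contraT => j0.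
have epsc := signs_constant (@addIr _ j) eps0 yS.
have yS1 x i s : y (step x i s) = step (y x) (i + j) (s * eps hone i).
  by rewrite yS epsc.
have [d d0 epsE] := rotation_signs (eps0 hone) yS1.
have {}yS1 x i s : y (step x i s) = step (y x) (i + j) (s * (d * wrap j i)).
  by rewrite yS1 epsE.
have j_gt0 : (0 < j)%N by rewrite lt0n.
pose k := logn 2 j; pose n := (2 ^ (a - k))%N; pose o := (j %/ 2 ^ k)%N.
have lt_ka : (k < a)%N.
  rewrite -(@ltn_exp2l 2) // -Na; apply: leq_ltn_trans (ltn_ord j).
  by rewrite dvdn_leq // pfactor_dvdnn.
have njE : (n * j = o * N)%N.
  have jE : (o * 2 ^ k)%N = j := divnK (pfactor_dvdnn 2 j).
  by rewrite -[X in (n * X)%N]jE mulnCA -expnD subnK ?(ltnW lt_ka) // -Na.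
have odd_o : odd o.
  rewrite /o /k -[odd _]negbK -dvdn2; apply/negP => h.
  have : (2 ^ (logn 2 j).+1 %| j)%N.
    by rewrite expnS -dvdn_divRL ?pfactor_dvdnn.
  by rewrite pfactor_dvdn // ltnn.
have gX x i b : (g ^+ n)%g (x, i, b) = (iter n y x, i + j *+ n, b).
  by rewrite permX; elim: n {njE} => [|q IHq] /=; rewrite ?addr0 // IHq gE mulrSr addrA.
have jn0 : j *+ n = 0 by apply: ord_inj; rewrite val_mulrn njE modnMl.
(* The global sign disappears because n is even. *)
have d1 : d ^+ n = 1.
  have -> : n = (2 * 2 ^ (a - k).-1)%N by rewrite -expnS prednK // subn_gt0.
  by rewrite exprM expr2 F3_sqr // expr1n.
case: (@not_semiregular_of_flip (g ^+ n)%g (iter n y) 0).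
- by move=> x i b; rewrite gX jn0 addr0.
- move=> x s; rewrite (rotation_iter yS1) jn0 d1 mul1r njE mulnK //.
  by rewrite -signr_odd odd_o expr1 mulrN1.
exact: semiregular_expg.
Qed.

(** The square fixes every index, and its signs are +1 because -1 is excluded by
    [not_semiregular_of_flip]; what remains is a left translation, of order
    dividing 3. *)
Lemma semiregular_order a (g : {perm vertex}) :
    N = (2 ^ a)%N -> g \in Aut_graph adj -> semiregular_perm g ->
  (#[g]%g <= 6)%N.
Proof.
move=> Na gA gsr; have [y [j [c [eps [gE eps0 yS]]]]] := aut_lines gA.
have g2E x i b : (g ^+ 2)%g (x, i, b) = (y (y x), i, b).
  rewrite expgS expg1 permM !gE -addbA addbb addbF.
  case: c gE yS => gE yS; rewrite /place; first by rewrite subKr.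
  rewrite (@semiregular_no_rotation a g y j eps Na gsr) ?addr0 //.
  by move=> x' i' b'; rewrite gE /place addbF.
have g2A : (g ^+ 2)%g \in Aut_graph adj by rewrite groupX.
have g2sr := semiregular_expg (n := 2%N) gsr.
have [z [j' [c' [eps' [hE eps'0 zS]]]]] := aut_lines g2A.
have hE0 := hE hone 0 false; rewrite g2E /= in hE0.
have c'0 : c' = false by have /= := congr1 snd hE0.
have j'0 : j' = 0.
  have /= := congr1 (fun v : vertex => v.1.2) hE0.
  by rewrite c'0 /place add0r => <-.
rewrite {}c'0 {}j'0 /place in hE zS {hE0}.
have epsc := signs_constant (@addIr _ 0) eps'0 zS.
have eps1 i : eps' hone i = 1.
  have := eps'0 hone i; case: (F3_cases (eps' hone i)) => E; rewrite E // => _.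
  case: (@not_semiregular_of_flip (g ^+ 2)%g z i) => //.
    by move=> x k b; rewrite hE addr0 addbF.
  by move=> x s; rewrite zS addr0 epsc E mulrN1.
have zM x : z x = hmul (z hone) x.
  move: x; apply: step_ind => [|x i s IHx]; first by rewrite hmulx1.
  by rewrite zS IHx addr0 epsc eps1 mulr1 /step hmulA.
suff g6 : ((g ^+ 2) ^+ 3 = 1)%g by rewrite dvdn_leq // order_dvdn (expgM g 2 3) g6.
apply/permP => -[[x i] b]; rewrite perm1 permX /= !hE /= !addr0 !addbF.
by move: (z hone) zM => k zM; rewrite !zM hmul_cubeK.
Qed.

Lemma card_vertex_ge : (N <= #|vertex|)%N.
Proof.
have K_gt0 : (0 < #|{: K}|)%N by apply/card_gt0P; exists hone.
rewrite 2!card_prod card_ord card_bool mulnAC.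
by apply: leq_pmull; rewrite muln_gt0 K_gt0.
Qed.

End Construction.

Theorem theorem1p2 :
  ~ exists f : nat -> nat,
      tends_to_infinity f /\
      forall (n : nat) (T : finType) (e : rel T),
        #|T| = n ->
        simple_graph e -> connected_graph e -> cubic e ->
        vertex_transitive e ->
        exists g : {perm T},
          [/\ g \in Aut_graph e, semiregular_perm g & f n <= #[g]%g].
Proof.
move=> [f [/(_ 7)[n0 f_ge7] fP]].
(* The exponent a is at least 2, so that N = m + 4 = 2^a, and N > n0. *)
pose a := n0.+2; pose m := 2 ^ a - 4.
have Na : m.+4 = 2 ^ a.
  by rewrite -[m.+4]addn4 subnK // -[4]/(2 ^ 2) leq_exp2l.
have [||||g [gA gsr]] := fP _ (vertex m) (@adj m) erefl.
- by split; [exact: adj_sym | exact: adj_irr].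
- exact: adj_connected.
- exact: adj_cubic.
- exact: adj_transitive.
have n0_le : n0 <= #|vertex m|.
  apply: leq_trans (card_vertex_ge m); rewrite Na.
  by apply: leq_trans (ltnW (ltn_expl a (ltnSn 1))); rewrite leqW.
by move/(leq_trans (f_ge7 _ n0_le)); rewrite ltnNge (semiregular_order Na).
Qed.
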